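(* Fix a parity and write $n=2k$ (even case) or $n=2k+1$ (odd case). Let $A_n$ be the connected anti-regular graph on $n$ vertices, let $\lambda^+_1(k)$ denote the smallest positive eigenvalue of $A_n$, and let $\lambda^-_1(k)$ denote the largest negative eigenvalue of $A_n$ different from the trivial eigenvalue $\lambda_0$ (where $\lambda_0=-1$ for $n$ even and $\lambda_0=0$ for $n$ odd). Then, within each parity class: (i) the sequence $(\lambda^+_1(k))_{k\ge 1}$ is strictly decreasing and converges to $\tfrac{-1+\sqrt{2}}{2}$; (ii) the sequence $(\lambda^-_1(k))_{k}$ (indexed by all $k\ge1$ for which it is defined) is strictly increasing and converges to $\tfrac{-1-\sqrt{2}}{2}$.
   Context: A simple graph is anti-regular if exactly two of its vertices have the same degree. For each $n\ge2$, $A_n$ denotes the unique (up to isomorphism) connected anti-regular graph on $n$ vertices; equivalently the threshold graph with creation sequence $(0,1,0,1,\dots,0,1)$ ($n$ even) or $(0,0,1,0,1,\dots,0,1)$ ($n$ odd), where a $1$ means the new vertex is joined to all previous vertices and a $0$ means it is added isolated. Eigenvalues are those of the adjacency matrix; the eigenvalues of $A_n$ are simple, and $-1$ (for $n$ even) resp. $0$ (for $n$ odd) is an eigenvalue, called the trivial eigenvalue $\lambda_0$. *)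

(* Defs.v *)
From HB Require Import structures.
From mathcomp Require Import all_boot all_order all_algebra.
From mathcomp Require Import classical_sets reals topology normedtype sequences.
From mathcomp Require Import zify.

Set Implicit Arguments.
Unset Strict Implicit.
Unset Printing Implicit Defensive.

Import Order.TTheory GRing.Theory Num.Theory.
Import numFieldNormedType.Exports.

Local Open Scope ring_scope.
Local Open Scope classical_set_scope.

Definition simple_graph (T : finType) (e : rel T) : Prop :=
  symmetric e /\ irreflexive e.

Definition connected_graph (T : finType) (e : rel T) : Prop :=
  (0 < #|T|)%N /\ forall x y, connect e x y.

Definition deg (T : finType) (e : rel T) (x : T) : nat := #|[set y | e x y]%SET|.

(* There is exactly one unordered pair of distinct vertices of equal degree. *)
Definition antiregular (T : finType) (e : rel T) : Prop :=
  exists u v : T, u != v /\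
    forall x y : T, x != y ->
      (deg e x = deg e y <-> [set x; y]%SET = [set u; v]%SET).

Definition connected_antiregular (T : finType) (e : rel T) : Prop :=
  [/\ simple_graph e, connected_graph e & antiregular e].

(* The threshold graph whose creation sequence has n entries, alternates and
   ends in 1: vertex m carries the bit odd (n - m), except that the bit of
   vertex 0 plays no role. *)
Definition alternating_threshold (n : nat) : rel 'I_n :=
  fun i j => (i != j) && odd (n - maxn i j).

Lemma count_odd_sub (n m : nat) : (m <= n)%N ->
  (\sum_(m <= j < n) odd (n - j) = uphalf (n - m))%N.
Proof.
move=> le_mn; have -> : m = (n - (n - m))%N by lia.
elim: (n - m)%N (leq_subr m n) => [|d IHd] le_dn.
  by rewrite subn0 big_geq // subnn.
rewrite big_ltn; last by lia.
have -> : (n - d.+1).+1 = (n - d)%N by lia.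
by rewrite IHd; lia.
Qed.

Lemma deg_alternating_threshold (n : nat) (i : 'I_n) :
  deg (@alternating_threshold n) i = (odd (n - i) * i + (n - i)./2)%N.
Proof.
rewrite /deg -sum1_card.
under eq_bigl do rewrite inE.
rewrite big_mkcond /= /alternating_threshold.
under eq_bigr => j _ do rewrite -val_eqE /=.
rewrite -(big_mkord xpredT
  (fun j : nat => if ((i : nat) != j) && odd (n - maxn i j) then 1 else 0)%N) /=.
have lt_in := ltn_ord i.
rewrite (@big_cat_nat _ _ _ i) //=; last exact: ltnW.
rewrite [X in (_ + X)%N]big_ltn // eqxx /= add0n.
congr (_ + _)%N.
  rewrite (eq_big_nat _ _ (F2 := fun=> nat_of_bool (odd (n - i)))); last first.
    move=> j /andP[_ lt_ji]; rewrite (maxn_idPl (ltnW lt_ji)).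
    by rewrite neq_ltn lt_ji orbT /=; case: odd.
  by rewrite sum_nat_const_nat subn0 mulnC.
rewrite (eq_big_nat _ _ (F2 := fun j => nat_of_bool (odd (n - j)))); last first.
  move=> j /andP[lt_ij _]; rewrite (maxn_idPr (ltnW lt_ij)).
  by rewrite neq_ltn lt_ij /=; case: odd.
by rewrite count_odd_sub //; lia.
Qed.

Lemma set2_ord01 (n : nat) (u v x y : 'I_n) :
  u = 0%N :> nat -> v = 1%N :> nat -> x != y ->
  ([set x; y]%SET = [set u; v]%SET) <-> (x + y = 1)%N.
Proof.
move=> u0 v1 neq_xy; split=> [eq_xy|xy1].
  have := set21 x y; have := set22 x y; rewrite eq_xy !inE -!val_eqE /= u0 v1.
  by move: neq_xy; rewrite -val_eqE /=; lia.
have [[x0 y1]|[x1 y0]] : (x = 0 :> nat /\ y = 1 :> nat)%N \/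
    (x = 1 :> nat /\ y = 0 :> nat)%N by lia.
  by congr [set _; _]%SET; apply: val_inj => /=; rewrite ?x0 ?y1.
by rewrite finset.setUC; congr [set _; _]%SET; apply: val_inj; rewrite /= ?x1 ?y0.
Qed.

Lemma alternating_threshold_connected_antiregular (n : nat) : (2 <= n)%N ->
  connected_antiregular (@alternating_threshold n).
Proof.
case: n => [|[|n]] // _; split; [split | split | idtac].
- by move=> i j; rewrite /alternating_threshold eq_sym maxnC.
- by move=> i; rewrite /alternating_threshold eqxx.
- by rewrite card_ord.
- have sym : symmetric (@alternating_threshold n.+2).
    by move=> i j; rewrite /alternating_threshold eq_sym maxnC.
  have top i : connect (@alternating_threshold n.+2) i ord_max.
    case: (eqVneq i ord_max) => [->|neq_i]; first exact: connect0.
    apply: connect1; rewrite /alternating_threshold neq_i /=.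
    have le_i : (i <= n.+1)%N by rewrite -ltnS.
    by rewrite (maxn_idPr le_i) subSnn.
  move=> x y; apply: (connect_trans (top x)).
  by rewrite (sym_connect_sym sym).
- exists ord0, (Ordinal (isT : 1 < n.+2)%N); split=> // x y neq_xy.
  rewrite (set2_ord01 _ _ neq_xy) // !deg_alternating_threshold.
  move: neq_xy (ltn_ord x) (ltn_ord y); rewrite -val_eqE /= => neq_xy lt_x lt_y.
  split=> [|xy1].
    case ox: (odd (n.+2 - x)); case oy: (odd (n.+2 - y)); rewrite ?mul1n ?mul0n; lia.
  have [[-> ->]|[-> ->]] : (x = 0 :> nat /\ y = 1 :> nat)%N \/
    (x = 1 :> nat /\ y = 0 :> nat)%N by lia.
    by rewrite subn0 subn1 muln0 muln1 /=; lia.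
  by rewrite subn0 subn1 muln0 muln1 /=; lia.
Qed.

Section Spectrum.
Variables (R : realType) (n : nat) (e : rel 'I_n).

Definition adjacency : 'M[R]_n := \matrix_(i, j) (e i j)%:R.

Definition positive_eigenvalues : set R :=
  [set l | eigenvalue adjacency l /\ 0 < l].

Definition trivial_eigenvalue : R := if odd n then 0 else -1.

Definition nontrivial_negative_eigenvalues : set R :=
  [set l | [/\ eigenvalue adjacency l, l < 0 & l != trivial_eigenvalue]].

Definition smallest_positive_eigenvalue (l : R) : Prop :=
  positive_eigenvalues l /\ lbound positive_eigenvalues l.

Definition largest_nontrivial_negative_eigenvalue (l : R) : Prop :=
  nontrivial_negative_eigenvalues l /\ ubound nontrivial_negative_eigenvalues l.

End Spectrum.

Arguments adjacency R {n} e.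
Arguments positive_eigenvalues R {n} e.
Arguments nontrivial_negative_eigenvalues R {n} e.

(* Main.v *)
(* In a connected anti-regular graph all degrees 1, ..., n - 1 occur, and peeling
   off the extreme degrees shows that x ~ y iff deg x + deg y >= n. Ranking the
   vertices by degree, the graph becomes i ~ j iff i + j >= n - 1 on {0, ..., n - 1}.
   For an eigenvalue l other than 0 and -1, the entries of an eigenvector read from
   the middle of this order downwards satisfy
     u_(j+2) = (2 - 1 / (l (l + 1))) u_(j+1) - u_j,
   and l is an eigenvalue iff u_k = 0. Put x = l for l > 0 and x = -1 - l for l < -1,
   and alternate signs: the recurrence coefficient becomes 1 / (x (x + 1)) - 2, which
   decreases in x and equals 2 at x = (sqrt 2 - 1) / 2. A discrete Sturm comparison
   then shows that the first positive zero in x strictly decreases with k. The limit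
   is that value of x: below it the recurrence has no zero, while above it the ratio
   of consecutive terms drops by a fixed amount at each step, so a sign change must
   occur. *)
Require Import Defs.
From HB Require Import structures.
From mathcomp Require Import all_boot all_order all_algebra.
From mathcomp Require Import classical_sets reals topology normedtype sequences.
From mathcomp Require Import boolp zify ring lra.

Set Implicit Arguments.
Unset Strict Implicit.
Unset Printing Implicit Defensive.

(* [lia] fails on goals containing cardinals unless these are first abstracted. *)
Ltac card_lia := repeat (let a := fresh "a" in set a := #|_|); lia.

(** * Degrees and canonical form of connected anti-regular graphs *)

Section Structure.
Variables (n : nat) (e : rel 'I_n).
Hypotheses (n_gt1 : (1 < n)%N) (e_ca : connected_antiregular e).

Let e_sym : symmetric e. Proof. by case: e_ca => -[]. Qed.
Let e_irr : irreflexive e. Proof. by case: e_ca => -[]. Qed.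

Lemma deg_lt (x : 'I_n) : (deg e x < n)%N.
Proof.
have : [set y | e x y] \subset [set~ x].
  by apply/fintype.subsetP => y; rewrite !inE; case: eqP => // ->; rewrite e_irr.
by move/subset_leq_card; rewrite cardsC1 card_ord /deg; lia.
Qed.

Lemma deg_gt0 (x : 'I_n) : (0 < deg e x)%N.
Proof.
have [y neq_yx] : exists y, y != x.
  have : (0 < #|[set~ x]|)%N by rewrite cardsC1 card_ord; lia.
  by case/card_gt0P => y; rewrite !inE; exists y.
case: e_ca => _ [_ conn] _.
case/connectP: (conn x y) => -[|z p] /=; first by move=> _ eq_yx; rewrite eq_yx eqxx in neq_yx.
by case/andP=> exz _ _; apply/card_gt0P; exists z; rewrite inE.
Qed.

(** Pigeonhole: dropping [u], one vertex of the pair of equal degree, leaves [n - 1] vertices with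
    distinct degrees among the [n - 1] values from 1 to [n - 1]. *)
Lemma deg_attained (d : nat) : (0 < d < n)%N -> exists x, deg e x = d.
Proof.
move=> /andP[d_gt0 d_lt]; case: e_ca => _ _ [u [v [neq_uv degP]]].
pose f x := Ordinal (deg_lt x).
have f_inj : {in [set~ u] &, injective f}.
  move=> x y; rewrite !inE => neq_xu neq_yu [eq_d].
  apply/eqP/negPn/negP => neq_xy; move/(degP x y neq_xy): eq_d => eq_xy.
  by have := set21 u v; rewrite -eq_xy !inE !(eq_sym u) (negPf neq_xu) (negPf neq_yu).
have n_gt0 : (0 < n)%N by lia.
have sub : f @: [set~ u] \subset [set~ Ordinal n_gt0].
  apply/fintype.subsetP => _ /imsetP[x _ ->]; rewrite !inE -val_eqE /=.
  by have := deg_gt0 x; lia.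
have /eqP im_f : f @: [set~ u] == [set~ Ordinal n_gt0].
  by rewrite eqEcard sub (card_in_imset f_inj) !cardsC1 leqnn.
have : Ordinal d_lt \in f @: [set~ u] by rewrite im_f !inE -val_eqE /=; lia.
by case/imsetP => x _ [->]; exists x.
Qed.

Lemma card_deg_range (i m : nat) : (0 < i)%N -> (i + m <= n)%N ->
  (m <= #|[set y | i <= deg e y < i + m]|)%N.
Proof.
move=> i_gt0; elim: m => [//|m IHm] le_n.
have [x dx] : exists x, deg e x = (i + m)%N by apply: deg_attained; lia.
have sub : x |: [set y | i <= deg e y < i + m] \subset [set y | i <= deg e y < i + m.+1].
  apply/fintype.subsetP => y; rewrite !inE => /orP[/eqP->|]; lia.
have := subset_leq_card sub; rewrite cardsU1 inE dx ltnn andbF /=.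
by move: (IHm ltac:(lia)); card_lia.
Qed.

Let adjacent_as_degrees (x : 'I_n) :=
  forall y, x != y -> e x y = (n <= deg e x + deg e y)%N.

(** The vertices of degree below [j] are already known not to be neighbours of [x]. There are at
    least [j - 1] of them, so together with [x] they leave at most [n - j] candidates, and [x] must
    be joined to all of these. *)
Lemma adjacent_high (j : nat) (x : 'I_n) : (0 < j)%N -> (j.*2 <= n)%N ->
  (forall y, (deg e y < j)%N -> adjacent_as_degrees y) ->
  deg e x = (n - j)%N -> adjacent_as_degrees x.
Proof.
move=> j_gt0 le_jn low dx.
pose S := [set y | (y != x) && (j <= deg e y)%N].
have sub : [set y | e x y] \subset S.
  apply/fintype.subsetP => y; rewrite !inE => exy.
  have neq_yx : y != x by apply: contraTneq exy => ->; rewrite e_irr.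
  rewrite neq_yx /= leqNgt; apply/negP => lt_yj.
  by move: exy; rewrite e_sym (low y) // dx; lia.
have card_low := @card_deg_range 1 j.-1 isT.
have subC : [set y | 1 <= deg e y < 1 + j.-1] \subset ~: S :\ x.
  by apply/fintype.subsetP => y; rewrite !inE; case: eqP => [->|_] /=; rewrite ?dx; lia.
have x_S : x \in ~: S by rewrite !inE eqxx.
have le_low := subset_leq_card subC.
have := cardsD1 x (~: S); rewrite x_S /= => eqC.
have cardS := cardsC S; rewrite card_ord in cardS.
have jn : (1 + j.-1 <= n)%N by lia.
have /eqP N_S : [set y | e x y] == S.
  rewrite eqEcard sub /=; move: (card_low jn) dx eqC cardS le_low; rewrite /deg; card_lia.
move=> y neq_xy.
have : (y \in [set y | e x y]) = (y \in S) by rewrite N_S.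
by rewrite !inE eq_sym neq_xy /= => ->; lia.
Qed.

(** Dually, at least [j] vertices of degree [n - j] or more are known to be neighbours of [x], and
    they exhaust its degree. *)
Lemma adjacent_low (j : nat) (x : 'I_n) : (0 < j)%N -> (j.*2 < n)%N ->
  (forall y, (n - j <= deg e y)%N -> adjacent_as_degrees y) ->
  deg e x = j -> adjacent_as_degrees x.
Proof.
move=> j_gt0 lt_jn high dx.
pose S := [set y | (n - j <= deg e y < n - j + j)%N].
have sub : S \subset [set y | e x y].
  apply/fintype.subsetP => y; rewrite !inE => /andP[le_y _].
  have neq_yx : y != x by apply/eqP => eq_yx; move: le_y; rewrite eq_yx dx; lia.
  by rewrite e_sym (high y) // dx; lia.
have /eqP N_S : S == [set y | e x y].
  rewrite eqEcard sub /=; have := @card_deg_range (n - j) j.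
  rewrite -/S; move: sub dx => _; rewrite /deg; card_lia.
move=> y neq_xy.
have : (y \in [set y | e x y]) = (y \in S) by rewrite N_S.
by rewrite !inE => ->; have := deg_lt y; lia.
Qed.

Lemma adjacent_degrees (x y : 'I_n) : e x y = (x != y) && (n <= deg e x + deg e y)%N.
Proof.
case: (eqVneq x y) => [->|neq_xy] /=; first exact: e_irr.
have ind j : (j.*2 < n)%N ->
    forall z, ((deg e z <= j) || (n - j <= deg e z))%N -> adjacent_as_degrees z.
  elim: j => [_ z|j IHj lt_jn].
    by have := deg_gt0 z; have := deg_lt z; lia.
  have {}IHj := IHj ltac:(lia).
  have hi z : (n - j.+1 <= deg e z)%N -> adjacent_as_degrees z.
    rewrite leq_eqVlt => /orP[/eqP dz|lt_z]; last by apply: IHj; lia.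
    by apply: (@adjacent_high j.+1) => // [|w dw]; [lia|apply: IHj; lia].
  move=> z /orP[|]; last exact: hi.
  rewrite leq_eqVlt => /orP[/eqP dz|lt_z]; last by apply: IHj; lia.
  by apply: (@adjacent_low j.+1).
have lt_half : ((n.-1)./2.*2 < n)%N by lia.
have := ind _ lt_half.
(* The peeling misses a degree only when [n] is even, namely [n./2]; one more use of [adjacent_high]
   settles it. *)
case: (boolP ((deg e x <= n.-1./2) || (n - n.-1./2 <= deg e x))%N) => [cx|cx] {}ind.
  exact: (ind x).
apply: (@adjacent_high n./2 x) => //; try lia.
by move=> w dw; apply: ind; lia.
Qed.

(** The complement is the neighbourhood of a vertex [x] of degree [n - m], together with [x] itself
    exactly when [m <= n - m]. *)
Lemma card_deg_lt (m : nat) : (0 < m <= n)%N ->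
  #|[set y | deg e y < m]%N| = (m - (m.*2 <= n))%N.
Proof.
case/andP=> m_gt0 le_mn.
case: (eqVneq m n) => [->|neq_mn].
  rewrite (_ : [set y | _]%SET = [set: _]%SET); last by apply/setP => y; rewrite !inE deg_lt.
  by rewrite cardsT card_ord; lia.
have [x dx] : exists x, deg e x = (n - m)%N by apply: deg_attained; lia.
have := cardsC [set y | deg e y < m]%N; rewrite card_ord.
have -> : ~: [set y | deg e y < m]%N =
    if (m.*2 <= n)%N then x |: [set y | e x y] else [set y | e x y].
  apply/setP => y; case: ifP => le2; rewrite !inE adjacent_degrees dx.
    by case: eqVneq => [->|] /=; rewrite ?dx; lia.
  by case: eqVneq => [<-|] /=; rewrite ?dx; lia.
case: ifP => _; rewrite ?cardsU1 ?inE ?e_irr -/(deg e x) dx; lia.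
Qed.

Definition degree_rank (x : 'I_n) : nat :=
  #|[set y | (deg e y < deg e x) || ((deg e y == deg e x) && (y < x))]%N|.

Lemma degree_rank_lt (x : 'I_n) : (degree_rank x < n)%N.
Proof.
have : [set y | (deg e y < deg e x) || ((deg e y == deg e x) && (y < x))]%N
    \subset [set~ x].
  by apply/fintype.subsetP => y; rewrite !inE; case: (eqVneq y x) => [->|] //; lia.
by move/subset_leq_card; rewrite cardsC1 card_ord /degree_rank; lia.
Qed.

Lemma degree_rank_inj : injective degree_rank.
Proof.
have mono x y : ((deg e x < deg e y) || ((deg e x == deg e y) && (x < y)))%N ->
    (degree_rank x < degree_rank y)%N.
  move=> lt_xy; apply: proper_card; apply/properP; split.
    by apply/fintype.subsetP => z; rewrite !inE; lia.
  by exists x; rewrite !inE ?lt_xy //; lia.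
move=> x y eq_r; apply: val_inj; apply/eqP; apply/negP => neq /=.
have := mono x y; have := mono y x; rewrite eq_r ltnn.
move: neq; rewrite /=; lia.
Qed.

(** The rank is thus the degree minus 1 for degrees below [n./2] and the degree itself above; only
    at [n./2] are two values possible. *)
Lemma degree_rank_bounds (x : 'I_n) :
  (deg e x - ((deg e x).*2 <= n) <= degree_rank x
     < (deg e x).+1 - ((deg e x).+1.*2 <= n))%N.
Proof.
have d0 := deg_gt0 x; have dn := deg_lt x.
apply/andP; split.
  rewrite -card_deg_lt; last by rewrite d0 ltnW.
  rewrite subset_leq_card //.
  by apply/fintype.subsetP => y; rewrite !inE => ->.
rewrite -card_deg_lt //; apply: proper_card; apply/properP; split.
  by apply/fintype.subsetP => y; rewrite !inE; lia.
by exists x; rewrite !inE ?ltnSn // ltnn eqxx ltnn.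
Qed.

Lemma connected_antiregular_canonical : exists2 phi : 'I_n -> 'I_n, injective phi &
  forall x y, e x y = (phi x != phi y) && (n <= phi x + phi y + 1)%N.
Proof.
pose phi x := Ordinal (degree_rank_lt x).
have phi_inj : injective phi by move=> x y [/degree_rank_inj].
exists phi => // x y; rewrite (inj_eq phi_inj) adjacent_degrees /=.
case: eqVneq => //= neq_xy.
(* For two vertices of degree [n./2] the bounds alone do not decide adjacency; that their ranks
   differ does. *)
have neq_r : degree_rank x != degree_rank y by rewrite (inj_eq degree_rank_inj).
by have := degree_rank_bounds x; have := degree_rank_bounds y; lia.
Qed.

End Structure.

(** * The three-term recurrence *)

Import Order.TTheory GRing.Theory Num.Theory.
Import numFieldNormedType.Exports.

Local Open Scope ring_scope.
Local Open Scope classical_set_scope.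

(** Chebyshev polynomials in [t / 2] with a free value at index 1: [a = t / 2] gives the first kind,
    [a = t] the second. *)
Fixpoint recur (R : nzRingType) (t a : R) (j : nat) : R :=
  if j is i.+1 then
    if i is h.+1 then t * recur t a i - recur t a h else a
  else 1.

Lemma recurSS (R : nzRingType) (t a : R) (j : nat) :
  recur t a j.+2 = t * recur t a j.+1 - recur t a j.
Proof. by []. Qed.

Lemma pair_ind (P : nat -> Prop) :
  P 0 -> P 1 -> (forall j, P j -> P j.+1 -> P j.+2) -> forall j, P j.
Proof.
move=> P0 P1 PS j; suff [] : P j /\ P j.+1 by [].
by elim: j => [//|j [Pj PSj]]; split=> //; apply: PS.
Qed.

Lemma recur_opp (R : comNzRingType) (t a : R) (j : nat) :
  recur (- t) (- a) j = (-1) ^+ j * recur t a j.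
Proof.
elim/pair_ind: j => [||j IHj IHSj]; rewrite ?recurSS ?IHj ?IHSj /=.
- by rewrite expr0 mul1r.
- by rewrite expr1 mulN1r.
- by rewrite !exprS; ring.
Qed.

(** Dropping the first term leaves a solution that starts with [a] and [t * a - 1]; dividing by [a]
    normalises it again. *)
Lemma recur_shift (F : fieldType) (t a : F) (j : nat) : a != 0 ->
  recur t a j.+1 = a * recur t (t - a^-1) j.
Proof.
move=> a_neq0; elim/pair_ind: j => [||j IHj IHSj].
- by rewrite /= mulr1.
- by rewrite /=; field.
- by rewrite recurSS IHj IHSj recurSS; ring.
Qed.

(** With [t >= 2] the increments of a positive solution never decrease, and the first one is
    [a - 1]. *)
Lemma recur_ge1 (R : realFieldType) (t a : R) (j : nat) :
  2 <= t -> 1 <= a -> 1 <= recur t a j.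
Proof.
move=> t_ge2 a_ge1.
suff [] : 1 <= recur t a j /\ recur t a j <= recur t a j.+1 by [].
elim: j => [//|j [ge1 mono]]; rewrite recurSS; split; first exact: le_trans mono.
by nra.
Qed.

(** * Sturm comparison and the first zeros of the recurrence *)

Section Sturm.
Variable R : realType.
Implicit Types (x y l : R).

(** The trace of the one-step transfer matrix, which has determinant 1; for [x > 0] it exceeds -2,
    and solutions oscillate once it falls below 2. *)
Definition trace_coef x : R := (x * (x + 1))^-1 - 2.

Definition edge : R := (-1 + Num.sqrt 2) / 2.

Lemma edge_gt0 : 0 < edge.
Proof.
rewrite /edge; have s_ge0 : 0 <= Num.sqrt 2 :> R by exact: sqrtr_ge0.
have s2 : Num.sqrt 2 ^+ 2 = 2 :> R by rewrite sqr_sqrtr.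
by nra.
Qed.

Lemma edgeE : edge * (edge + 1) = 4^-1.
Proof.
rewrite /edge.
have s2 : Num.sqrt 2 ^+ 2 = 2 :> R by rewrite sqr_sqrtr.
set s := Num.sqrt 2 in s2 *.
have -> : (-1 + s) / 2 * ((-1 + s) / 2 + 1) = (s ^+ 2 - 1) / 4 by field.
by rewrite s2; field.
Qed.

Lemma trace_coef_edge : trace_coef edge = 2.
Proof. by rewrite /trace_coef edgeE invrK; ring. Qed.

Lemma trace_coef_decr x y : 0 < x -> x < y -> trace_coef y < trace_coef x.
Proof.
move=> x_gt0 lt_xy; rewrite /trace_coef ltrD2r ltf_pV2 ?posrE; nra.
Qed.

(** The term of index 1 is kept abstract to serve both signs of the eigenvalue and both parities.
    Monotonicity is asked only where [0 <= q y], because both choices of [start_neg] increase again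
    for large arguments. *)
Variable q : R -> R.
Hypothesis q_decr : forall x y, 0 < x -> x < y -> 0 <= q y -> q y < q x.
Hypothesis q_cont : forall x, 0 < x -> {for x, continuous q}.
Hypothesis q_edge : 1 <= q edge.
Hypothesis q_le0 : exists2 z, 0 < z & q z <= 0.

Let v j x := recur (trace_coef x) (q x) j.

Let vSS j x : v j.+2 x = trace_coef x * v j.+1 x - v j x. Proof. by []. Qed.

(* The Casoratian of the solutions at [x] and [y] stays positive, so the solution at
   [x < y] keeps its sign for as long as the one at [y] does. *)
Lemma recur_compare k x y : 0 < x -> x < y ->
  (forall j, (j <= k)%N -> 0 < v j y) -> 0 <= v k.+1 y ->
  forall j, (j <= k.+1)%N -> 0 < v j x.
Proof.
move=> x_gt0 lt_xy pos_y last_y.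
have ge0_y j : (j <= k.+1)%N -> 0 <= v j y.
  by rewrite leq_eqVlt => /orP[/eqP->//|lt_jk]; apply/ltW/pos_y.
have lt_t := trace_coef_decr x_gt0 lt_xy.
have cas j : (j <= k)%N -> 0 < v j x /\ v j x * v j.+1 y < v j.+1 x * v j y.
  elim: j => [_|j IHj lt_jk].
    by split; rewrite /v /= ?ltr01 // mul1r mulr1 q_decr // (ge0_y 1%N).
  have [pos_x cmp] := IHj (ltnW lt_jk).
  have pos_yj := pos_y j (ltnW lt_jk); have pos_ySj := pos_y _ lt_jk.
  have pos_xS : 0 < v j.+1 x by rewrite -(pmulr_lgt0 _ pos_yj); nra.
  (* From one index to the next the Casoratian gains [(trace_coef x - trace_coef y) * v j.+1 x * v
     j.+1 y]. *)
  by split=> //; rewrite !vSS; have := mulr_gt0 pos_xS pos_ySj; nra.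
move=> j; rewrite leq_eqVlt => /orP[/eqP->|/cas[]//].
have [pos_x cmp] := cas k (leqnn k).
by rewrite -(pmulr_lgt0 _ (pos_y k (leqnn k))); have := ge0_y _ (leqnn _); nra.
Qed.

Lemma continuous_recur j x : 0 < x -> {for x, continuous (v j)}.
Proof.
move=> x_gt0; elim/pair_ind: j => [||j IHj IHSj].
- exact: cvg_cst.
- exact: q_cont.
- rewrite /v; apply: cvgB => //; apply: cvgM => //; apply: cvgB; last exact: cvg_cst.
  apply: cvgV; first by rewrite mulf_neq0 ?gt_eqF ?addr_gt0.
  by apply: cvgM; [exact: cvg_id|apply: cvgD; [exact: cvg_id|exact: cvg_cst]].
Qed.

Lemma recur_zero_between j y : edge <= y -> v j y < 0 \/ v j y = 0 ->
  exists2 l, edge < l <= y & v j l = 0.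
Proof.
move=> le_ey vy.
have v_edge : 1 <= v j edge by apply: recur_ge1 => //; rewrite trace_coef_edge.
have [||l l_in vl] := @IVT R (v j) edge y 0 le_ey.
- apply: continuous_in_subspaceT => x; rewrite inE /= in_itv /= => /andP[le_ex _].
  exact/continuous_recur/(lt_le_trans edge_gt0).
- rewrite ge_min le_max; apply/andP; split; apply/orP; [right|left].
    by case: vy => [/ltW//|->].
  lra.
- exists l => //; move: l_in; rewrite in_itv /= lt_neqAle => /andP[-> ->].
  by rewrite !andbT; apply/eqP => eq_l; move: v_edge; rewrite eq_l vl; lra.
Qed.

(** The index is [k.+1] because term 0 is constantly 1. Positivity of the earlier terms is what
    [recur_compare] needs to make [l] the smallest positive zero. *)
Definition first_zero k l := [/\ edge < l, v k.+1 l = 0 &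
  forall j, (j <= k)%N -> 0 < v j l].

(** At a zero [l] of term [k.+1] the recurrence gives [v k.+2 l = - v k l < 0], while every term is
    at least 1 at [edge]; so the next zero lies between them. *)
Lemma first_zero_exists k : exists l, first_zero k l.
Proof.
elim: k => [|k [l [lt_el vl pos_l]]].
  have [z z_gt0 qz] := q_le0.
  have [lt_ze|le_ez] := ltP z edge.
    have [q_ge|q_lt] := lerP 0 (q edge); last by move: q_lt q_edge; lra.
    by have := q_decr z_gt0 lt_ze q_ge; move: q_edge qz; lra.
  have [|l /andP[lt_el _] vl] := @recur_zero_between 1 z le_ez.
    by move: qz; rewrite le_eqVlt => /orP[/eqP|]; [right|left].
  by exists l; split=> // j; rewrite leqn0 => /eqP->; exact: ltr01.
have vSS_l : v k.+2 l < 0 by rewrite vSS vl mulr0 sub0r oppr_lt0; exact: pos_l.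
have [|l' /andP[lt_el' le_l'] vl'] := @recur_zero_between k.+2 l (ltW lt_el).
  by left.
have lt_l' : l' < l.
  by rewrite lt_neqAle le_l' andbT; apply/eqP => eq_l; move: vSS_l; rewrite -eq_l vl' ltxx.
exists l'; split=> //.
by apply: (recur_compare (lt_trans edge_gt0 lt_el') lt_l' pos_l); rewrite vl.
Qed.

Lemma first_zero_pos k l x : first_zero k l -> 0 < x -> x < l -> v k.+1 x != 0.
Proof.
case=> _ vl pos_l x_gt0 lt_xl; rewrite gt_eqF //.
by apply: (recur_compare x_gt0 lt_xl pos_l); rewrite ?vl.
Qed.

(** If [l < l'], positivity of term [k.+1] at [l'] would carry over to [l], where that term
    vanishes. *)
Lemma first_zero_decr k l l' : first_zero k l -> first_zero k.+1 l' -> l' < l.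
Proof.
case=> lt_el vl pos_l [lt_el' vl' pos_l'].
rewrite ltNge le_eqVlt; apply/negP => /orP[/eqP eq_l|lt_l].
  by have := pos_l' k.+1 (leqnn _); rewrite -eq_l vl ltxx.
have := recur_compare (lt_trans edge_gt0 lt_el) lt_l pos_l'.
by rewrite vl' => /(_ (lexx 0) k.+1 (leqnSn _)); rewrite vl ltxx.
Qed.

(* Since [r + 1 / r >= 2], the ratio [r] of consecutive positive terms decreases by at
   least [2 - trace_coef y] at each step. *)
Lemma recur_pos_bound k y : edge < y -> (forall j, (j <= k.+1)%N -> 0 < v j y) ->
  k%:R * (2 - trace_coef y) < q y.
Proof.
move=> lt_ey pos_y; set d := 2 - trace_coef y.
have ratio j : (j <= k)%N -> v j.+1 y <= (q y - j%:R * d) * v j y.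
  elim: j => [_|j IHj lt_jk]; first by rewrite mul0r subr0 /v /= mulr1.
  have := IHj (ltnW lt_jk); set r := q y - j%:R * d => le_r.
  have v0 := pos_y j (leq_trans (ltnW lt_jk) (leqnSn _)).
  have v1 := pos_y j.+1 (leq_trans lt_jk (leqnSn _)).
  have r_gt0 : 0 < r by rewrite -(pmulr_lgt0 _ v0); exact: lt_le_trans le_r.
  have -> : q y - j.+1%:R * d = r - d by rewrite /r -natr1; ring.
  rewrite vSS (_ : trace_coef y = 2 - d); last by rewrite /d; ring.
  suff : 2 * v j.+1 y - v j y <= r * v j.+1 y by lra.
  rewrite -(ler_pM2l r_gt0); have := sqr_ge0 (r - 1); nra.
have := lt_le_trans (pos_y k.+1 (leqnn _)) (ratio k (leqnn _)).
by rewrite pmulr_lgt0 ?pos_y // subr_gt0.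
Qed.

Lemma first_zero_lt y : edge < y ->
  exists K, forall k l, (K <= k)%N -> first_zero k l -> l < y.
Proof.
move=> lt_ey.
have d_gt0 : 0 < 2 - trace_coef y.
  by rewrite subr_gt0 -trace_coef_edge trace_coef_decr // edge_gt0.
(* The successor compensates for [recur_pos_bound], where positivity up to index [k.+1] bounds only
   [k%:R]. *)
exists (Num.bound (`|q y| / (2 - trace_coef y))).+1 => -[//|k] l le_k [lt_el vl pos_l].
rewrite ltNge; apply/negP => le_yl.
have : k%:R * (2 - trace_coef y) < q y.
  apply: recur_pos_bound => // j le_j.
  move: le_yl; rewrite le_eqVlt => /orP[/eqP->|lt_yl]; first exact: pos_l.
  by apply: (recur_compare (lt_trans edge_gt0 lt_ey) lt_yl pos_l); rewrite ?vl // ltnW.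
rewrite -ltr_pdivlMr // => lt_kq.
have := archi_boundP (divr_ge0 (normr_ge0 (q y)) (ltW d_gt0)).
have : (Num.bound (`|q y| / (2 - trace_coef y)))%:R <= k%:R :> R by rewrite ler_nat.
have : q y / (2 - trace_coef y) <= `|q y| / (2 - trace_coef y).
  by rewrite ler_pM2r ?invr_gt0 // ler_norm.
by lra.
Qed.

Lemma first_zeros : exists l : nat -> R,
  [/\ forall k, 0 < l k,
      forall k, recur (trace_coef (l k)) (q (l k)) k.+1 = 0,
      forall k x, 0 < x -> x < l k -> recur (trace_coef x) (q x) k.+1 != 0,
      {homo l : j k / (j < k)%N >-> k < j} &
      l k @[k --> \oo] --> edge].
Proof.
have [l lP] := choice first_zero_exists.
exists l; split=> [k|k|k x x_gt0 lt_x||].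
- by have [lt_el _ _] := lP k; exact: lt_trans edge_gt0 lt_el.
- by have [_ vl _] := lP k.
- exact: first_zero_pos (lP k) x_gt0 lt_x.
- apply: homo_ltn => [y x z lt_yx lt_zy|k]; first exact: lt_trans lt_zy lt_yx.
  exact: first_zero_decr (lP k) (lP k.+1).
- apply/cvgrPdist_lt => eps eps_gt0.
  have [K ltK] : exists K, forall k l, (K <= k)%N -> first_zero k l -> l < edge + eps.
    by apply: first_zero_lt; rewrite ltrDl.
  exists K => // k /= le_Kk.
  have [lt_el _ _] := lP k; have := ltK k _ le_Kk (lP k).
  by rewrite ltr_norml; lra.
Qed.

End Sturm.

(** * From eigenvectors to the recurrence *)

Section Eigen.
Variable R : realType.
Implicit Types (l : R) (v : nat -> R).

(* The eigenvector equations of the graph [i ~ j] iff [i != j] and [n <= i + j + 1], with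
   [v a] added on both sides whenever [a] satisfies [n <= a + a + 1]. *)
Definition tail_system n l v := forall a, (a < n)%N ->
  (l + (n <= a.*2.+1)%:R) * v a = \sum_(0 <= b < a.+1) v (n.-1 - b)%N.

(** Subtracting consecutive equations leaves a single term of the sum. *)
Lemma tail_system_steps n l v : (0 < n)%N -> tail_system n l v <->
  (l + (n == 1%N)%:R) * v 0%N = v n.-1 /\
  forall a, (a.+1 < n)%N ->
    (l + (n <= a.+1.*2.+1)%:R) * v a.+1 - (l + (n <= a.*2.+1)%:R) * v a = v (n - a.+2)%N.
Proof.
move=> n_gt0.
have n1 : (n == 1)%N = (n <= 0.*2.+1)%N by lia.
rewrite n1; split=> [sys|[v0 vS]].
  split; first by rewrite sys // big_nat1 subn0.
  move=> a lt_an; rewrite !sys //; last by lia.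
  by rewrite big_nat_recr //= [X in X - _]addrC addrK; congr v; lia.
elim=> [|a IHa] lt_an; first by rewrite v0 big_nat1 subn0.
rewrite big_nat_recr //= -IHa; last exact: ltnW.
have := vS a lt_an; rewrite (_ : n - a.+2 = n.-1 - a.+1)%N; last by lia.
by move<-; rewrite addrC subrK.
Qed.

Lemma sum_tail n v a : (a < n)%N ->
  \sum_(0 <= b < a.+1) v (n.-1 - b)%N = \sum_(i < n | (n <= i + a + 1)%N) v i.
Proof.
move=> lt_an.
rewrite -(big_mkord (fun i => n <= i + a + 1)%N v).
rewrite [RHS](@big_cat_nat _ _ _ (n.-1 - a)) //=; last by lia.
rewrite [X in _ = X + _]big_nat_cond [X in _ = X + _]big_pred0 ?add0r; last by move=> i; lia.
rewrite big_nat_rev /= -[(n.-1 - a)%N in RHS]add0n big_addn.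
rewrite (_ : n - (n.-1 - a) = a.+1)%N; last by lia.
rewrite [RHS]big_nat_cond [LHS]big_nat_cond; apply: eq_big => [i|i /andP[]]; first by lia.
by move=> lt_i _; congr v; lia.
Qed.

Lemma eigenvalue_tail_system n (e : rel 'I_n) (phi : 'I_n -> 'I_n) l :
  injective phi ->
  (forall x y, e x y = (phi x != phi y) && (n <= phi x + phi y + 1)%N) ->
  eigenvalue (adjacency R e) l <->
  exists v, (exists2 a, (a < n)%N & v a != 0) /\ tail_system n l v.
Proof.
move=> phi_inj eE.
(* Adding the loop term restores the summand excluded by [i != phi y], so the neighbour sum becomes
   a full tail. *)
have sysE v (y : 'I_n) : (\sum_x v (phi x) * (e x y)%:R = l * v (phi y)) <->
    (l + (n <= (phi y).*2.+1)%:R) * v (phi y) =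
    \sum_(0 <= b < (phi y).+1) v (n.-1 - b)%N.
  rewrite sum_tail // mulrDl.
  rewrite (eq_bigr (fun x => v (phi x) * ((phi x != phi y) && (n <= phi x + phi y + 1)%N)%:R));
    last by move=> x _; rewrite eE.
  rewrite -(reindex_inj (P := xpredT) (F := fun i : 'I_n =>
    v i * ((i != phi y) && (n <= i + phi y + 1)%N)%:R) phi_inj) /=.
  rewrite [X in X = _ <-> _](bigD1 (phi y)) //=.
  rewrite [X in _ <-> _ = X]big_mkcond [X in _ <-> _ = X](bigD1 (phi y)) //=.
  rewrite eqxx mulr0 add0r (eq_bigr (fun i : 'I_n => if (n <= i + phi y + 1)%N then v i else 0));
    last by move=> i ->; case: ifP; rewrite ?mulr1 ?mulr0.
  rewrite (_ : (phi y + phi y + 1 = (phi y).*2.+1)%N); last by lia.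
  set S := \sum_(i < n | i != phi y) _; case: ifP => _ ; rewrite ?mul1r ?mul0r; split; lra.
have [g phiK gK] := injF_bij phi_inj.
split=> [eig|[v [[a lt_an va] sys]]].
  have [w wA w_neq0] := eigenvalueP eig.
  pose v a := if insub a is Some i then w ord0 (g i) else 0.
  have vE x : v (phi x) = w ord0 x by rewrite /v valK phiK.
  exists v; split.
    have [x wx] : exists x, w ord0 x != 0.
      by apply/existsP; apply: contraNT w_neq0; rewrite negb_exists => /forallP w0;
        apply/eqP/rowP => x; rewrite mxE; apply/eqP; rewrite -[_ == _]negbK.
    by exists (phi x); rewrite ?vE.
  move=> a lt_an; rewrite -[a]/(val (Ordinal lt_an)) -(gK (Ordinal lt_an)).
  apply/sysE; have /rowP/(_ (g (Ordinal lt_an))) := wA; rewrite !mxE !vE => <-.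
  by apply: eq_bigr => x _; rewrite vE mxE.
apply/eigenvalueP; exists (\row_x v (phi x)).
  apply/rowP => y; rewrite !mxE -(iffRL (sysE v y)) ?sys //.
  by apply: eq_bigr => x _; rewrite !mxE.
apply: contraNneq va => /rowP/(_ (g (Ordinal lt_an))); rewrite !mxE gK /= => ->.
by rewrite eqxx.
Qed.

(* Entries in the lower half, read from the middle outwards; the value 0 past the end is
   the boundary condition. *)
Definition lower k v i : R := if (i < k)%N then v (k.-1 - i)%N else 0.

(** The difference of two consecutive rows has its loop term in neither row (lower half), in one
    (the middle) or in both (upper half). For odd order the middle difference reads
    [l * v k = l * v k.-1], whence the last clause. *)
Lemma tail_system_blocks k (b : bool) l v : (0 < k)%N -> l != 0 ->
  let u := lower k v in
  let w i := v (k + b + i)%N in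
  tail_system (k.*2 + b) l v <->
  [/\ forall i, (i < k)%N -> l * (u i - u i.+1) = w i,
      (l + 1) * w 0%N = (l + 1 + b%:R) * u 0%N,
      forall i, (i.+1 < k)%N -> (l + 1) * (w i.+1 - w i) = u i.+1 &
      b -> v k = u 0%N].
Proof.
move=> k_gt0 l0 u w; have n_gt0 : (0 < k.*2 + b)%N by lia.
have u0 : u 0%N = v k.-1 by rewrite /u /lower k_gt0 subn0.
have low a : (a < k)%N -> (k.*2 + b <= a.*2.+1)%N = false by lia.
have high a : (k <= a)%N -> (k.*2 + b <= a.*2.+1)%N = true by lia.
rewrite (tail_system_steps _ _ n_gt0); split=> [[v0 vS]|[uw w0 wu vk]].
  have n1 : (k.*2 + b == 1)%N = false by lia.
  have mid : (l + 1) * v k - l * v k.-1 = v (k.-1 + b)%N.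
    have := vS k.-1; rewrite prednK // high // low; last by rewrite prednK.
    by rewrite addr0 => ->; [congr v|]; lia.
  have vk : b -> v k = u 0%N.
    move=> b1; apply: (mulfI l0); move: mid; rewrite u0 b1 addn1 prednK //; lra.
  split=> // [i lt_ik||i lt_ik].
  - rewrite /u /w /lower lt_ik; case: ltnP => [lt_Sik|le_kSi].
      have := vS (k.-1 - i.+1)%N; rewrite (_ : (k.-1 - i.+1).+1 = k.-1 - i)%N; last by lia.
      rewrite !low; try lia.
      by rewrite addr0 mulrBr => ->; [congr v|]; lia.
    have eq_i : i = k.-1 by lia.
    by move: v0; rewrite n1 addr0 subr0 eq_i subnn => ->; congr v; lia.
  - rewrite /w addn0; move: mid vk (vS k); rewrite -u0.
    have [b1|/negbTE b0] := orP (orbN b); last first.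
      by rewrite b0 !addn0 -u0 mulr0n addr0 => mid _ _; move: mid; lra.
    rewrite !high; try lia.
    rewrite b1 !addn1 => _ vk /(_ ltac:(lia)).
    rewrite (_ : _ - _ = k.-1)%N; last by lia.
    by rewrite vk // -u0 !mulr1n; lra.
  - have := vS (k + b + i)%N; rewrite !high; try lia.
    rewrite /w addnS mulrBr /u /lower lt_ik => -> ; [congr v|]; lia.
split.
  have := uw k.-1; rewrite /u /w /lower prednK // ltnn leqnn subnn subr0.
  rewrite (_ : (k.*2 + b == 1)%N = false); last by lia.
  by rewrite addr0 => ->; [congr v|]; lia.
move=> a lt_an; have [lt_ak|lt_ka|eq_ak] := ltngtP a.+1 k.
- have := uw (k - a.+2)%N; rewrite /u /w /lower.
  rewrite !low; try lia.
  rewrite (_ : k - a.+2 < k)%N; last by lia.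
  rewrite (_ : (k - a.+2).+1 < k)%N; last by lia.
  rewrite (_ : k.-1 - (k - a.+2) = a.+1)%N; last by lia.
  rewrite (_ : k.-1 - (k - a.+2).+1 = a)%N; last by lia.
  by rewrite addr0 mulrBr => ->; [congr v|]; lia.
- rewrite !high; try lia.
  have [eq_a|neq_a] := eqVneq (b : nat) (a.+1 - k)%N.
    have b1 : b by lia.
    have eq_ak : a = k by move: eq_a; rewrite b1; lia.
    rewrite eq_ak (vk b1); move: w0; rewrite /w b1 addn0 !addn1.
    rewrite (_ : k.*2.+1 - k.+2 = k.-1)%N -?u0; last by lia.
    rewrite !mulr1n; lra.
  have lt_b : (b < a.+1 - k)%N by lia.
  have := wu (a - k - b)%N; rewrite /w /u /lower.
  rewrite (_ : (a - k - b).+1 < k)%N; last by lia.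
  rewrite (_ : k + b + (a - k - b).+1 = a.+1)%N; last by lia.
  rewrite (_ : k + b + (a - k - b) = a)%N; last by lia.
  by rewrite mulrBr => ->; [congr v|]; lia.
- rewrite (high a.+1) ?(low a); try lia.
  have a_k1 : a = k.-1 by lia.
  rewrite eq_ak a_k1 -u0 addr0 (_ : k.*2 + b - k.+1 = k.-1 + b)%N; last by lia.
  have [b1|/negbTE b0] := orP (orbN b).
    by rewrite b1 addn1 prednK // (vk b1) !mulr1n; lra.
  by move: w0; rewrite /w b0 !addn0 -u0 mulr0n addr0 ?mulr1n => ->; lra.
Qed.

Definition ratio_coef l : R := 2 - (l * (l + 1))^-1.

Definition start_coef (b : bool) l : R := 1 - (l + 1 + b%:R) / (l * (l + 1)).

(** The upper entries [w] are eliminated between the two families of block equations. The case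
    [j = k] carries the boundary condition. *)
Lemma tail_system_recur k (b : bool) l v : (0 < k)%N -> l != 0 -> l != -1 ->
  tail_system (k.*2 + b) l v ->
  forall j, (j <= k)%N ->
    lower k v j = recur (ratio_coef l) (start_coef b l) j * lower k v 0.
Proof.
move=> k_gt0 l0 l1 /(tail_system_blocks _ _ k_gt0 l0)[uw w0 wu _].
have l10 : l + 1 != 0 by rewrite addr_eq0.
elim/pair_ind => [_|lt_1k|j IHj IHSj lt_jk]; first by rewrite mul1r.
  apply: (mulfI l0); apply: (mulfI l10); have := uw 0%N k_gt0; move: w0.
  set w := v _; move=> w0 uw0; move: w0; rewrite -uw0 /= /start_coef => w0.
  have -> : (l + 1) * (l * lower k v 1) =
    (l + 1) * l * lower k v 0 - (l + 1) * (l * (lower k v 0 - lower k v 1)) by ring.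
  by rewrite w0; field; rewrite ?l0 ?l10.
have := wu j lt_jk; rewrite -!uw //; try lia.
rewrite recurSS mulrBl -mulrA -IHj; last by lia.
rewrite -IHSj; last by lia.
move=> rel; apply: (mulfI l0); apply: (mulfI l10).
have -> : (l + 1) * (l * lower k v j.+2) =
   (l + 1) * l * (2 * lower k v j.+1 - lower k v j) -
   (l + 1) * (l * (lower k v j.+1 - lower k v j.+2) - l * (lower k v j - lower k v j.+1)) by ring.
by rewrite rel /ratio_coef; field; rewrite ?l0 ?l10.
Qed.

Lemma tail_system_eq0 k (b : bool) l v : (0 < k)%N -> l != 0 ->
  tail_system (k.*2 + b) l v -> (forall j, (j < k)%N -> lower k v j = 0) ->
  forall a, (a < k.*2 + b)%N -> v a = 0.
Proof.
move=> k_gt0 l0 /(tail_system_blocks _ _ k_gt0 l0)[uw _ _ vk] low0 a lt_an.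
have {}low0 j : lower k v j = 0.
  by case: (ltnP j k) => [/low0//|]; rewrite /lower ltnNge => ->.
have [lt_ak|le_ka] := ltnP a k.
  have := low0 (k.-1 - a)%N; rewrite /lower (_ : k.-1 - a < k)%N; last by lia.
  by rewrite (_ : k.-1 - (k.-1 - a) = a)%N //; lia.
have [/andP[b1 /eqP->]|] := boolP (b && (a == k)); first by rewrite vk.
move=> nmid; have := uw (a - k - b)%N; rewrite !low0 subr0 mulr0.
by move=> uw_a; rewrite [RHS]uw_a; [congr v|]; lia.
Qed.

Lemma tail_system_nonzeroP k (b : bool) l : (0 < k)%N -> l != 0 -> l != -1 ->
  (exists v, (exists2 a, (a < k.*2 + b)%N & v a != 0) /\ tail_system (k.*2 + b) l v) <->
  recur (ratio_coef l) (start_coef b l) k = 0.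
Proof.
move=> k_gt0 l0 l1; have l10 : l + 1 != 0 by rewrite addr_eq0.
split=> [[v [[a lt_an va] sys]]|rec0].
  have rec := tail_system_recur k_gt0 l0 l1 sys.
  have /eqP := rec k (leqnn k); rewrite {1}/lower ltnn eq_sym mulf_eq0.
  case/orP => [/eqP//|/eqP u0].
  case/eqP: va; apply: (tail_system_eq0 k_gt0 l0 sys) => // j lt_jk.
  by rewrite rec 1?ltnW // u0 mulr0.
pose U := recur (ratio_coef l) (start_coef b l).
(* The lower half is the recurrence started at 1, the middle entry repeats that 1, and the upper
   half is forced by the first block equation. *)
pose v a := if (a < k)%N then U (k.-1 - a)%N else
  if b && (a == k) then 1 else l * (U (a - (k + b))%N - U (a - (k + b)).+1).
exists v.
have low i : (i <= k)%N -> lower k v i = U i.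
  rewrite /lower leq_eqVlt => /orP[/eqP->|lt_ik]; first by rewrite ltnn /U rec0.
  rewrite lt_ik /v (_ : k.-1 - i < k)%N; last by lia.
  by rewrite (_ : k.-1 - (k.-1 - i) = i)%N //; lia.
have upp i : v (k + b + i)%N = l * (U i - U i.+1).
  rewrite /v addKn (_ : k + b + i < k = false)%N; last by lia.
  by rewrite (_ : b && _ = false) //; lia.
split; first by exists k.-1; rewrite /v ?prednK ?leqnn ?subnn /= ?oner_eq0 //; lia.
apply/(tail_system_blocks _ _ k_gt0 l0); split=> [i lt_ik||i lt_ik|b1].
- by rewrite upp !low // ltnW.
- by rewrite upp low // /U /= /start_coef; field; rewrite ?l0 ?l10.
- rewrite !upp low /U ?recurSS 1?ltnW // /ratio_coef.
  by field; rewrite ?l0 ?l10.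
- by rewrite low // /v ltnn b1 eqxx.
Qed.

(** The factor [l + 1] vanishes, so the block equations force the lower half to be 0; the entry
    [u 0] is reached only through [b%:R = 1]. *)
Lemma tail_system_odd_neqN1 k v : (0 < k)%N ->
  tail_system (k.*2 + true) (-1) v -> forall a, (a < k.*2 + true)%N -> v a = 0.
Proof.
move=> k_gt0 sys; have l0 : -1 != 0 :> R by rewrite oppr_eq0 oner_eq0.
apply: (tail_system_eq0 k_gt0 l0 sys).
have [_ w0 wu _] := iffLR (tail_system_blocks true v k_gt0 l0) sys.
case=> [_|j lt_jk]; last by rewrite -wu // addNr mul0r.
by move: w0; rewrite addNr mul0r add0r mul1r.
Qed.

End Eigen.

(** * The starting values for positive and negative eigenvalues *)

Section Zeros.
Variable R : realType.
Implicit Types (b : bool) (x y l : R).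

Definition start_pos b x := (x + 1 + b%:R) / (x * (x + 1)) - 1.

(* For even order the first step of the recurrence at [l = -1 - x] is eliminated by
   [recur_shift], whence the index shift [k - ~~ b] below. *)
Definition start_neg b x :=
  if b then (1 - x) / (x * (x + 1)) - 1
  else trace_coef x + (x + 1) / (x + 2).

Lemma edge_lt : edge R < 4^-1.
Proof. by have := edge_gt0 R; have := edgeE R; nra. Qed.

Lemma start_pos_zeros b : exists z : nat -> R,
  [/\ forall k, 0 < z k,
      forall k, recur (trace_coef (z k)) (start_pos b (z k)) k.+1 = 0,
      forall k x, 0 < x -> x < z k -> recur (trace_coef x) (start_pos b x) k.+1 != 0,
      {homo z : j k / (j < k)%N >-> k < j} &
      z k @[k --> \oo] --> edge R].
Proof.
have b_ge0 : 0 <= b%:R :> R by exact: ler0n.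
apply: first_zeros.
- move=> x y x_gt0 lt_xy _; rewrite /start_pos ltrD2r.
  have y_gt0 := lt_trans x_gt0 lt_xy.
  have split_frac (w : R) : 0 < w ->
      (w + 1 + b%:R) / (w * (w + 1)) = w^-1 + b%:R * (w * (w + 1))^-1.
    by move=> w_gt0; field; rewrite !gt_eqF //; lra.
  rewrite !split_frac //; apply: ltr_leD; first by rewrite ltf_pV2.
  apply: ler_wpM2l => //; rewrite lef_pV2 ?posrE; nra.
- move=> x x_gt0; apply: cvgB; last exact: cvg_cst.
  apply: cvgM.
    by apply: cvgD; [apply: cvgD; [exact: cvg_id|exact: cvg_cst]|exact: cvg_cst].
  apply: cvgV; first by rewrite mulf_neq0 ?gt_eqF ?addr_gt0.
  by apply: cvgM; [exact: cvg_id|apply: cvgD; [exact: cvg_id|exact: cvg_cst]].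
- by rewrite /start_pos edgeE invrK; have := edge_gt0 R; lra.
- exists 2; rewrite // /start_pos.
  have b_le1 : b%:R <= 1 :> R by case: b {b_ge0}.
  by rewrite subr_le0 ler_pdivrMr; lra.
Qed.

Lemma start_neg_zeros b : exists z : nat -> R,
  [/\ forall k, 0 < z k,
      forall k, recur (trace_coef (z k)) (start_neg b (z k)) k.+1 = 0,
      forall k x, 0 < x -> x < z k -> recur (trace_coef x) (start_neg b x) k.+1 != 0,
      {homo z : j k / (j < k)%N >-> k < j} &
      z k @[k --> \oo] --> edge R].
Proof.
have cont_inv x : 0 < x -> {for x, continuous (fun y : R => (y * (y + 1))^-1)}.
  move=> x_gt0; apply: cvgV; first by rewrite mulf_neq0 ?gt_eqF ?addr_gt0.
  by apply: cvgM; [exact: cvg_id|apply: cvgD; [exact: cvg_id|exact: cvg_cst]].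
apply: first_zeros; rewrite /start_neg; case: b.
- move=> x y x_gt0 lt_xy; have y_gt0 := lt_trans x_gt0 lt_xy.
  have yy_gt0 : 0 < y * (y + 1) by nra.
  have xx_gt0 : 0 < x * (x + 1) by nra.
  (* Nonnegativity at [y] gives [y * (y + 1) <= 1 - y], hence [y < 1], where the numerator is
     positive and decreasing and the denominator increasing. *)
  rewrite subr_ge0 ler_pdivlMr // mul1r ltrD2r => le_y.
  rewrite ltr_pdivrMr // mulrAC ltr_pdivlMr //.
  apply: (@lt_trans _ _ ((1 - y) * (y * (y + 1)))).
    by rewrite ltr_pM2l; [nra|lra].
  by rewrite ltr_pM2r //; lra.
- move=> x y x_gt0 lt_xy; have y_gt0 := lt_trans x_gt0 lt_xy.
  have y2_gt0 : 0 < y + 2 by lra.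
  have x2_gt0 : 0 < x + 2 by lra.
  have yy_gt0 : 0 < y * (y + 1) by nra.
  have xx_gt0 : 0 < x * (x + 1) by nra.
  have frac_lt1 : (y + 1) / (y + 2) < 1 by rewrite ltr_pdivrMr //; lra.
  move=> qy_ge0.
  have y_lt1 : y < 1.
    have : 1 < (y * (y + 1))^-1 by move: qy_ge0; rewrite /trace_coef; lra.
    by rewrite -[X in X < _]invr1 ltf_pV2 ?posrE //; nra.
  (* The last factor is positive since [x * y < 1 < x + y + 1] and
     [(x + 1) * (y + 1) < (x + 2) * (y + 2)]. *)
  rewrite -subr_gt0 (_ : _ - _ = (y - x) / (x * (x + 1) * (y * (y + 1)) * ((x + 2) * (y + 2))) *
     ((x + y + 1) * ((x + 2) * (y + 2)) - x * (x + 1) * (y * (y + 1)))); last first.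
    by rewrite /trace_coef; field; rewrite !gt_eqF //; lra.
  apply: mulr_gt0.
    by apply: divr_gt0; [rewrite subr_gt0|rewrite !mulr_gt0 //; lra].
  have : x * y < 1 by nra.
  have : (x + 1) * (y + 1) < (x + 2) * (y + 2) by nra.
  have : 0 < (x + 1) * (y + 1) by nra.
  set P := (x + 1) * (y + 1); set Q := (x + 2) * (y + 2) => P_gt0 lt_PQ lt_xy1.
  have -> : x * (x + 1) * (y * (y + 1)) = x * y * P by rewrite /P; ring.
  by nra.
- move=> x x_gt0; apply: cvgB; last exact: cvg_cst.
  by apply: cvgM; [apply: cvgB; [exact: cvg_cst|exact: cvg_id]|exact: cont_inv].
- move=> x x_gt0; apply: cvgD.
    by apply: cvgB; [exact: cont_inv|exact: cvg_cst].
  apply: cvgM; first by apply: cvgD; [exact: cvg_id|exact: cvg_cst].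
  apply: cvgV; first by rewrite gt_eqF ?addr_gt0.
  by apply: cvgD; [exact: cvg_id|exact: cvg_cst].
- by rewrite edgeE invrK; have := edge_lt; lra.
- rewrite trace_coef_edge.
  have : 0 <= (edge R + 1) / (edge R + 2) by apply: divr_ge0; have := edge_gt0 R; lra.
  by lra.
- by exists 1; rewrite // subrr mul0r sub0r oppr_le0.
- exists 1; rewrite // /trace_coef (_ : _ + _ = - (5 / 6)); first by lra.
  by field.
Qed.

End Zeros.

(** * Eigenvalues as zeros of the recurrence *)

Section AntiregularSpectrum.
Variables (R : realType) (k : nat) (b : bool) (e : rel 'I_(k.*2 + b)).
Hypotheses (k_gt0 : (0 < k)%N) (e_ca : connected_antiregular e).
Implicit Types l : R.

Lemma antiregular_eigenvalueP l : l != 0 -> l != -1 ->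
  eigenvalue (adjacency R e) l <-> recur (ratio_coef l) (start_coef b l) k = 0.
Proof.
move=> l0 l1; have n_gt1 : (1 < k.*2 + b)%N by lia.
have [phi phi_inj eE] := connected_antiregular_canonical n_gt1 e_ca.
by rewrite (eigenvalue_tail_system _ phi_inj eE) tail_system_nonzeroP.
Qed.

Lemma antiregular_odd_eigenvalueN1 : b -> ~ eigenvalue (adjacency R e) (-1).
Proof.
have n_gt1 : (1 < k.*2 + b)%N by lia.
have [phi phi_inj eE] := connected_antiregular_canonical n_gt1 e_ca.
move=> b1; rewrite (eigenvalue_tail_system _ phi_inj eE) b1.
case=> v [[a lt_an /eqP va] /(tail_system_odd_neqN1 k_gt0) v0].
exact/va/v0.
Qed.

Lemma recur_opp_eq0 (t a : R) j : (recur (- t) (- a) j = 0) <-> (recur t a j = 0).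
Proof.
rewrite recur_opp; split=> [/eqP|->]; last by rewrite mulr0.
by rewrite mulf_eq0 signr_eq0 => /eqP.
Qed.

Lemma positive_eigenvaluesP l : positive_eigenvalues R e l <->
  0 < l /\ recur (trace_coef l) (start_pos b l) k = 0.
Proof.
rewrite /positive_eigenvalues /= -recur_opp_eq0.
suff lE : 0 < l -> eigenvalue (adjacency R e) l <->
    recur (- trace_coef l) (- start_pos b l) k = 0.
  by split=> [[eig l_gt0]|[l_gt0 rec0]]; split=> //; exact/lE.
move=> l_gt0; rewrite antiregular_eigenvalueP ?gt_eqF //; last by lra.
rewrite (_ : - trace_coef l = ratio_coef l); last by rewrite /ratio_coef /trace_coef; ring.
by rewrite (_ : - start_pos b l = start_coef b l) // /start_coef /start_pos; ring.
Qed.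

(** The substitution [x = -1 - l] preserves [l * (l + 1)]. Nothing is lost by requiring [x > 0]:
    there is no eigenvalue between -1 and 0, and -1 is trivial for even order and not an eigenvalue
    for odd order. *)
Lemma nontrivial_negative_eigenvaluesP l : nontrivial_negative_eigenvalues R e l <->
  0 < -1 - l /\ recur (trace_coef (-1 - l)) (start_neg b (-1 - l)) (k - ~~ b) = 0.
Proof.
have lE : l < -1 -> eigenvalue (adjacency R e) l <->
    recur (trace_coef (-1 - l)) (start_neg b (-1 - l)) (k - ~~ b) = 0.
  move=> l_lt; have l0 : l != 0 by rewrite lt_eqF //; lra.
  have l1 : l + 1 != 0 by rewrite lt_eqF //; lra.
  rewrite antiregular_eigenvalueP //; last by rewrite -addr_eq0.
  rewrite -recur_opp_eq0.
  have -> : - ratio_coef l = trace_coef (-1 - l).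
    rewrite /ratio_coef /trace_coef (_ : (-1 - l) * (-1 - l + 1) = l * (l + 1)); last by ring.
    by ring.
  have startE : - start_coef b l = (b%:R + (l + 1)) / (l * (l + 1)) - 1.
    by rewrite /start_coef; ring.
  rewrite startE /start_neg; case: b => /=.
    rewrite subn0 (_ : (-1 - l) * (-1 - l + 1) = l * (l + 1)); last by ring.
    by rewrite (_ : 1%:R + (l + 1) = 1 - (-1 - l)) //; ring.
  rewrite subn1 -[in X in X <-> _](prednK k_gt0).
  have -> : (0%:R + (l + 1)) / (l * (l + 1)) - 1 = l^-1 - 1 by field; rewrite l0.
  have l_inv : l^-1 - 1 != 0.
    by rewrite lt_eqF // subr_lt0 (lt_trans _ ltr01) // invr_lt0; lra.
  rewrite recur_shift // (_ : - (l^-1 - 1)^-1 = (-1 - l + 1) / (-1 - l + 2)); last first.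
    by field; rewrite l0 /=; apply/andP; split; [rewrite gt_eqF //; lra|].
  split=> [/eqP|->]; last by rewrite mulr0.
  by rewrite mulf_eq0 (negPf l_inv) => /eqP.
split=> [[l_eig l_lt0 l_triv]|[l_lt rec0]].
  suff l_lt : l < -1 by split; [lra|apply/lE].
  case: (ltgtP l (-1)) => // [l_gt|l_eq].
    have l0 : l != 0 by rewrite lt_eqF.
    move: l_eig; rewrite antiregular_eigenvalueP // ?gt_eqF // => rec0.
    (* Here [l * (l + 1) < 0] pushes the coefficient above 2 and the starting value to at least 1,
       so no term vanishes. *)
    have ll_lt0 : (l * (l + 1))^-1 < 0 by rewrite invr_lt0; nra.
    have : 1 <= recur (ratio_coef l) (start_coef b l) k.
      apply: recur_ge1; first by rewrite /ratio_coef; lra.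
      have : 0 <= l + 1 + b%:R by have := ler0n R b; lra.
      by rewrite /start_coef; nra.
    by rewrite rec0 ler10.
  move: l_triv l_eig; rewrite l_eq /trivial_eigenvalue oddD odd_double addFb oddb.
  move=> l_triv; suff b1 : b by move/(antiregular_odd_eigenvalueN1 b1).
  by apply: contraNT l_triv => /negbTE->.
have l_lt' : l < -1 by lra.
split; [exact/lE|lra|]; rewrite /trivial_eigenvalue.
by case: odd; rewrite lt_eqF //; lra.
Qed.

End AntiregularSpectrum.

Theorem theorem2p4 (R : realType) (A : forall n : nat, rel 'I_n)
    (hA : forall n, (2 <= n)%N -> connected_antiregular (A n)) (parity : bool) :
  let G k := A (k.*2 + parity)%N in
  let defined k := (1 <= k)%N /\ nontrivial_negative_eigenvalues R (G k) !=set0 in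
  (exists lp : nat -> R,
    [/\ forall k, (1 <= k)%N -> smallest_positive_eigenvalue (G k) (lp k),
        forall j k, (1 <= j)%N -> (j < k)%N -> lp k < lp j &
        lp k @[k --> \oo] --> (-1 + Num.sqrt 2) / 2]) /\
  (exists lm : nat -> R,
    [/\ forall k, defined k -> largest_nontrivial_negative_eigenvalue (G k) (lm k),
        forall j k, defined j -> defined k -> (j < k)%N -> lm j < lm k,
        \forall k \near \oo, defined k &
        lm k @[k --> \oo] --> (-1 - Num.sqrt 2) / 2]).
Proof.
move=> G defined.
have ca k : (1 <= k)%N -> connected_antiregular (G k).
  by move=> k_gt0; apply: hA; lia.
split.
  have [z [z_gt0 z0 zN z_decr z_cvg]] := start_pos_zeros R parity.
  (* [z k] belongs to term [k.+1], hence the predecessor. *)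
  exists (fun k => z k.-1); split=> [[//|k] _|[//|j] [//|k] _ lt_jk|].
  - have P := positive_eigenvaluesP (ltn0Sn k) (ca _ (ltn0Sn k)).
    split; first by apply/P; split.
    move=> l /P[l_gt0 /eqP rec0]; rewrite leNgt; apply: contraTN rec0.
    exact: zN.
  - exact: z_decr.
  - by rewrite -cvg_shiftS.
have [z [z_gt0 z0 zN z_decr z_cvg]] := start_neg_zeros R parity.
have P k (k_gt0 : (0 < k)%N) := @nontrivial_negative_eigenvaluesP R k parity _ k_gt0 (ca k k_gt0).
have subNN x : -1 - (-1 - x) = x :> R by ring.
(* Only the graph on two vertices is excluded: there the index [k - ~~ parity] is 0 and the term is
   1. *)
have definedP k : defined k <-> ((~~ parity) < k)%N.
  split=> [[k_gt0 [l /(P k k_gt0)[_ rec0]]]|lt_k].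
    rewrite ltnNge; apply/negP => le_k; move: rec0.
    have -> : (k - ~~ parity = 0)%N by lia.
    by move/eqP; rewrite oner_eq0.
  have k_gt0 : (0 < k)%N by lia.
  split=> //; exists (-1 - z (k - (~~ parity).+1)%N); apply/P => //.
  rewrite subNN; split=> //.
  by rewrite -[in X in recur _ _ X](@prednK (k - ~~ parity)) -?subnS ?subn_gt0.
(* One shift comes from the numbering of the zeros, the other, for even order, from [recur_shift].
   Negation turns decreasing zeros into increasing eigenvalues. *)
exists (fun k => -1 - z (k - (~~ parity).+1)%N); split.
- move=> k /definedP lt_k; have k_gt0 : (0 < k)%N by lia.
  have kE : (k - ~~ parity = (k - (~~ parity).+1).+1)%N by lia.
  split; first by apply/P => //; rewrite subNN kE.
  move=> l /(P k k_gt0)[l_lt]; rewrite kE => /eqP rec0.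
  rewrite leNgt; apply: contraTN rec0 => lt_l.
  by apply: zN => //; lra.
- move=> j k /definedP lt_j /definedP lt_k lt_jk.
  by rewrite ltrD2l ltrN2; apply: z_decr; lia.
- by exists (~~ parity).+1 => // k /= lt_k; apply/definedP.
- rewrite -(cvg_shiftn (~~ parity).+1) /=.
  have -> : (-1 - Num.sqrt 2) / 2 = -1 - edge R by rewrite /edge; field.
  apply: cvgB; first exact: cvg_cst.
  by under eq_fun do rewrite addnK.
Qed.
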